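(* Fix $m,n\in \mathbb{N}$. Let $A\in \mathbb{R}^{m\times n}$ be a matrix of rank $r = \alpha n$ for some $0 < \alpha < 1$. Suppose that $A$ is $(k,D)$-$\ell_2$-ARIP for some $k\ge 1$ and $D\ge 1$. Fix $\eta > 0$ such that $\frac{64D^8}{(1-\alpha)^4}\le n^\eta \le \frac{k}{D^2}$. Then there is a submatrix $T\in \mathbb{R}^{t\times n}$ consisting of some rows of $A$, for some $t \le m$, with the following properties: (1) $\frac{\|T\|_F^2}{\|A\|_F^2} \ge n^{-\eta}$; (2) $t \ge \frac{k}{D^2n^\eta}$; (3) every row $x$ of $T$ satisfies $$\Delta_{1,2}(x) \le O\left(\left(\frac{D^3 n}{\eta \sqrt{1-\alpha}\log n}\right)^{1/2}\right).$$ In particular, every row of $T$ is $\sqrt{s/n}$-far from all $s$-sparse vectors, where $s = \Omega\left(\frac{\eta \sqrt{1-\alpha}\log n}{D^3}\right)$.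
   Context: For nonzero $x\in\mathbb{R}^n$, $\Delta_{1,2}(x) = \frac{\|x\|_2 \sqrt{n}}{\|x\|_1}$. A matrix $A\in\mathbb{R}^{m\times n}$ is $(k,D)$-$\ell_2$-ARIP if there exists $K > 0$ such that $K\|x\|_2 \le \|Ax\|_2\le D K\|x\|_2$ for every nonzero $x\in \mathbb{R}^n$ with $\Delta_{1,2}(x) \ge (n/k)^{1/2}$. $\|A\|_F$ is the Frobenius norm. Implicit constants in $O(\cdot),\Omega(\cdot)$ are absolute. A vector is $s$-sparse if it has at most $s$ nonzero entries; ''$x$ is $\varepsilon$-far from all $s$-sparse vectors'' means $\|x-y\|_2>\varepsilon\|x\|_2$ for every $s$-sparse $y$. *)

(* Defs.v *)
From mathcomp Require Export all_boot all_order all_algebra.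
From mathcomp Require Export reals exp.

Set Implicit Arguments.
Unset Strict Implicit.
Unset Printing Implicit Defensive.

Import Order.TTheory GRing.Theory Num.Theory.
Local Open Scope ring_scope.

Definition l1norm (R : realType) (n : nat) (x : 'cV[R]_n) : R :=
  \sum_(i < n) `|x i 0|.

Definition l2norm (R : realType) (n : nat) (x : 'cV[R]_n) : R :=
  Num.sqrt (\sum_(i < n) x i 0 ^+ 2).

Definition frobenius (R : realType) (m n : nat) (A : 'M[R]_(m, n)) : R :=
  Num.sqrt (\sum_(i < m) \sum_(j < n) A i j ^+ 2).

(* Meaningful for x != 0 only; at x = 0 division by zero makes it 0. *)
Definition Delta12 (R : realType) (n : nat) (x : 'cV[R]_n) : R :=
  l2norm x * Num.sqrt n%:R / l1norm x.

Definition l2_ARIP (R : realType) (m n : nat) (k D : R) (A : 'M[R]_(m, n)) :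
    Prop :=
  exists2 K : R, 0 < K &
    forall x : 'cV[R]_n, x != 0 -> Num.sqrt (n%:R / k) <= Delta12 x ->
      K * l2norm x <= l2norm (A *m x) <= D * K * l2norm x.

(* The sparsity level s is real: it is compared with the number of nonzero
   entries without rounding. *)
Definition sparse (R : realType) (n : nat) (s : R) (x : 'cV[R]_n) : Prop :=
  #|[set i | x i 0 != 0]|%:R <= s.

Definition far_from_sparse (R : realType) (n : nat) (eps s : R)
    (x : 'cV[R]_n) : Prop :=
  forall y : 'cV[R]_n, sparse s y -> eps * l2norm x < l2norm (x - y).

(* Main.v *)
Require Import Defs.
From mathcomp Require Import all_boot all_order all_algebra.
From mathcomp Require Import reals sequences exp ring lra.

Set Implicit Arguments.
Unset Strict Implicit.
Unset Printing Implicit Defensive.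

Import Order.TTheory GRing.Theory Num.Theory.
Local Open Scope ring_scope.

(** Call a row [a] spread when [|a|_1^2 > L |a|_2^2], with [L] a small multiple
    of [eta sqrt(1 - alpha) ln n / D^3], and take the spread rows for [T].
    Were their mass below [n^(-eta/2) |A|_F^2], discard the columns that are
    heavy in the spread rows or have large [l1] interaction with the other
    rows (Markov: at most a [(1 - alpha)/2] fraction), and let [B] be the rest
    of [A]. By the trace of the projection onto the kernel of [B], some kept
    [e_j] has a projection of squared norm at least [(1 - alpha)/2]. Descent
    [x <- x - B^T B x / (D K)^2] from [e_j] keeps that projection, while its
    [l1] norm grows slowly because the rows of [B] are compressible. So the
    iterates stay in the range of the ARIP, which makes [|x|_2^2] contract by
    [1 - 1/(2 D^2)] at each step: a contradiction after about
    [D^2 (1 - alpha)^(-1/4)] steps. If [L < 1], every nonzero row is spread.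
    A row has mass at most [4 n (D K)^2 / k], by the ARIP on blocks of [k]
    coordinates, whence the bound on [t]. *)

Section SpreadRows.
Variable R : realType.

(** * Inner product, squared norm and [l1] norm *)

Definition dot n (x y : 'cV[R]_n) : R := \sum_i x i 0 * y i 0.
Definition sqn n (x : 'cV[R]_n) : R := \sum_i x i 0 ^+ 2.

Lemma sqn_ge0 n (x : 'cV[R]_n) : 0 <= sqn x.
Proof. by apply: sumr_ge0 => i _; apply: sqr_ge0. Qed.

Lemma sqn_eq0 n (x : 'cV[R]_n) : sqn x = 0 -> x = 0.
Proof.
move=> /eqP; rewrite psumr_eq0 => [/allP h|i _]; last exact: sqr_ge0.
apply/colP => i; rewrite mxE.
by have := h i (mem_index_enum i); rewrite /= sqrf_eq0 => /eqP.
Qed.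

Lemma l2norm_sqr n (x : 'cV[R]_n) : l2norm x ^+ 2 = sqn x.
Proof. by rewrite sqr_sqrtr // sqn_ge0. Qed.

Lemma l1norm_ge0 n (x : 'cV[R]_n) : 0 <= l1norm x.
Proof. exact: sumr_ge0. Qed.

Lemma sqn_delta n (j : 'I_n) : sqn (delta_mx j 0 : 'cV[R]_n) = 1.
Proof.
rewrite /sqn (bigD1 j) //= big1 => [|i ij].
  by rewrite addr0 mxE !eqxx expr1n.
by rewrite mxE (negbTE ij) expr0n.
Qed.

Lemma l1norm_delta n (j : 'I_n) : l1norm (delta_mx j 0 : 'cV[R]_n) = 1.
Proof.
rewrite /l1norm (bigD1 j) //= big1 => [|i ij].
  by rewrite addr0 mxE !eqxx normr1.
by rewrite mxE (negbTE ij) normr0.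
Qed.

Lemma sqn0 n : sqn (0 : 'cV[R]_n) = 0.
Proof. by rewrite /sqn big1 // => i _; rewrite mxE expr0n. Qed.

Lemma l1norm0 n : l1norm (0 : 'cV[R]_n) = 0.
Proof. by rewrite /l1norm big1 // => i _; rewrite mxE normr0. Qed.

Lemma sqn_subscale n (a b : R) (x y : 'cV[R]_n) :
  sqn (a *: x - b *: y) =
    a ^+ 2 * sqn x - 2 * (a * b) * dot x y + b ^+ 2 * sqn y.
Proof.
rewrite /sqn /dot !mulr_sumr -sumrB -big_split /=.
by apply: eq_bigr => i _; rewrite !mxE; ring.
Qed.

Lemma dotC n (x y : 'cV[R]_n) : dot x y = dot y x.
Proof. by apply: eq_bigr => i _; rewrite mulrC. Qed.

Lemma dotxx n (x : 'cV[R]_n) : dot x x = sqn x.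
Proof. by apply: eq_bigr => i _; rewrite expr2. Qed.

Lemma dot_mulmx m n (A : 'M[R]_(m, n)) (x : 'cV[R]_n) (y : 'cV[R]_m) :
  dot (A *m x) y = dot x (A^T *m y).
Proof.
rewrite /dot.
under eq_bigr do rewrite mxE mulr_suml.
rewrite exchange_big /=; apply: eq_bigr => j _.
rewrite mxE mulr_sumr; apply: eq_bigr => i _; rewrite mxE; ring.
Qed.

Lemma l1norm_sub_scale n (b : R) (x y : 'cV[R]_n) : 0 <= b ->
  l1norm (x - b *: y) <= l1norm x + b * l1norm y.
Proof.
move=> b0; rewrite /l1norm mulr_sumr -big_split /=; apply: ler_sum => i _.
by rewrite !mxE (le_trans (ler_normB _ _)) // normrM ger0_norm.
Qed.

(** * Weighted Cauchy-Schwarz and mixed [l1]-[l2] bounds *)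

(** By Lagrange's identity the gap is half the double sum of [w i * w j * (a i - a j) ^+ 2]. *)
Lemma weighted_cauchy (I : finType) (w a : I -> R) : (forall i, 0 <= w i) ->
  (\sum_i w i * a i) ^+ 2 <= (\sum_i w i) * (\sum_i w i * a i ^+ 2).
Proof.
move=> w0.
have : 0 <= \sum_i \sum_j w i * w j * (a i - a j) ^+ 2.
  apply: sumr_ge0 => i _; apply: sumr_ge0 => j _.
  by rewrite mulr_ge0 ?sqr_ge0 // mulr_ge0.
have -> : \sum_i \sum_j w i * w j * (a i - a j) ^+ 2 =
    2 * ((\sum_i w i) * (\sum_i w i * a i ^+ 2) - (\sum_i w i * a i) ^+ 2).
  have -> : 2 * ((\sum_i w i) * (\sum_i w i * a i ^+ 2)
                 - (\sum_i w i * a i) ^+ 2)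
    = (\sum_i w i * a i ^+ 2) * (\sum_i w i)
      + (\sum_i w i) * (\sum_i w i * a i ^+ 2)
      + (\sum_i (- 2) * (w i * a i)) * (\sum_i w i * a i).
    by rewrite -mulr_sumr; ring.
  rewrite !big_distrlr /= -!big_split /=; apply: eq_bigr => i _.
  by rewrite -!big_split /=; apply: eq_bigr => j _; ring.
by rewrite pmulr_rge0 ?ltr0n // subr_ge0.
Qed.

Lemma l1norm_sparse n (x : 'cV[R]_n) (S : {set 'I_n}) :
  (forall i, i \notin S -> x i 0 = 0) ->
  l1norm x ^+ 2 <= #|S|%:R * sqn x.
Proof.
move=> xS; pose w i : R := (i \in S)%:R.
have -> : l1norm x = \sum_i w i * `|x i 0|.
  apply: eq_bigr => i _; rewrite /w; case: (boolP (i \in S)) => iS.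
    by rewrite mul1r.
  by rewrite (xS _ iS) normr0 mulr0.
have -> : sqn x = \sum_i w i * `|x i 0| ^+ 2.
  apply: eq_bigr => i _; rewrite /w; case: (boolP (i \in S)) => iS.
    by rewrite mul1r real_normK // num_real.
  by rewrite (xS _ iS) normr0 expr0n mulr0.
have -> : #|S|%:R = \sum_i w i.
  rewrite -sum1_card natr_sum big_mkcond; apply: eq_bigr => i _.
  by rewrite /w; case: (_ \in _).
by apply: weighted_cauchy => i; rewrite ler0n.
Qed.

Lemma sqn_le_l1norm n (x : 'cV[R]_n) : sqn x <= l1norm x ^+ 2.
Proof.
rewrite expr2 {1}/l1norm mulr_suml; apply: ler_sum => i _.
rewrite -real_normK ?num_real // expr2 ler_wpM2l //.
by rewrite /l1norm (bigD1 i) //= lerDl sumr_ge0.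
Qed.

(** Cauchy-Schwarz with weights [|x_j|], applied in each row to the entries multiplied by the sign
    of [x_j]. It limits what the spread rows contribute to [A *m x] when [x] is supported on columns
    that are light on them. *)
Lemma sqn_mulmx_le_l1norm m n (A : 'M[R]_(m, n)) (g : R) (G : pred 'I_m)
    (x : 'cV[R]_n) :
  (forall j, x j 0 != 0 -> \sum_(i | G i) A i j ^+ 2 <= g) ->
  \sum_(i | G i) (A *m x) i 0 ^+ 2 <= g * l1norm x ^+ 2.
Proof.
move=> hg.
apply: (@le_trans _ _
  (\sum_(i | G i) l1norm x * \sum_j `|x j 0| * A i j ^+ 2)).
  apply: ler_sum => i _.
  have := @weighted_cauchy _ (fun j => `|x j 0|)
    (fun j => Num.sg (x j 0) * A i j) (fun j => normr_ge0 _).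
  have -> : \sum_j `|x j 0| * (Num.sg (x j 0) * A i j) = (A *m x) i 0.
    rewrite mxE; apply: eq_bigr => j _.
    by rewrite mulrA [_ * Num.sg _]mulrC -numEsg mulrC.
  move=> /le_trans -> //; apply: ler_wpM2l; first exact: l1norm_ge0.
  apply: ler_sum => j _; rewrite exprMn; case: (eqVneq (x j 0) 0) => [->|xj].
    by rewrite normr0 !mul0r.
  by rewrite sqr_sg xj mul1r.
rewrite -mulr_sumr exchange_big /= expr2 mulrCA.
apply: ler_wpM2l; first exact: l1norm_ge0.
rewrite {1}/l1norm mulr_sumr; apply: ler_sum => j _.
rewrite -mulr_sumr mulrC; case: (eqVneq (x j 0) 0) => [->|xj].
  by rewrite normr0 !mulr0.
by apply: ler_wpM2r => //; apply: hg.
Qed.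

(** The sum in the hypothesis is the [l]-th column sum of [|B|^T |B|], absolute values being taken
    entrywise, so [M] bounds [B^T *m B] as an operator on [l1]. *)
Lemma l1norm_gram m n (B : 'M[R]_(m, n)) (M : R) (x : 'cV[R]_n) :
  (forall l, \sum_i `|B i l| * (\sum_j `|B i j|) <= M) ->
  l1norm (B^T *m (B *m x)) <= M * l1norm x.
Proof.
move=> hM.
apply: (@le_trans _ _ (\sum_j \sum_i `|B i j| * \sum_l `|B i l| * `|x l 0|)).
  apply: ler_sum => j _; rewrite mxE (le_trans (ler_norm_sum _ _ _)) //.
  apply: ler_sum => i _; rewrite normrM !mxE ler_wpM2l //.
  rewrite (le_trans (ler_norm_sum _ _ _)) //.
  by apply: ler_sum => l _; rewrite normrM.
rewrite exchange_big /=.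
under eq_bigr do rewrite -mulr_suml mulr_sumr.
rewrite exchange_big /= /l1norm mulr_sumr; apply: ler_sum => l _.
rewrite [leLHS](_ : _ = (\sum_i `|B i l| * (\sum_j `|B i j|)) * `|x l 0|).
  by apply: ler_wpM2r.
by rewrite mulr_suml; apply: eq_bigr => i _; ring.
Qed.

(** * Orthogonal projection onto a kernel *)

Lemma gram_unit p n (N : 'M[R]_(p, n)) : row_free N -> N *m N^T \in unitmx.
Proof.
move=> freeN; rewrite -row_free_unit -kermx_eq0; apply/rowV0P => v /sub_kermxP.
rewrite mulmxA => vNN.
have vN0 : v *m N = 0.
  apply: trmx_inj; rewrite trmx0; apply: sqn_eq0.
  transitivity ((v *m N *m (v *m N)^T) 0 0).
    by rewrite mxE; apply: eq_bigr => i _; rewrite mxE expr2 !mxE.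
  by rewrite trmx_mul mulmxA vNN mul0mx mxE.
by apply/eqP; rewrite -(mulmx_free_eq0 _ freeN) vN0.
Qed.

(** The witness is [N^T (N N^T)^-1 N], where the rows of [N] form a basis of the kernel; [kermx] is
    a left kernel, hence the transpose of [B]. Cyclicity reduces the trace to that of an identity
    matrix. *)
Lemma kernel_projection m n (B : 'M[R]_(m, n)) :
  exists P : 'M[R]_n,
    [/\ P^T = P, P *m P = P, B *m P = 0 & \tr P = n%:R - (\rank B)%:R].
Proof.
have [p [N [freeN NB pE]]] : exists p (N : 'M[R]_(p, n)),
    [/\ row_free N, N *m B^T = 0 & p%:R = n%:R - (\rank B)%:R :> R].
  exists (\rank (kermx B^T)), (row_base (kermx B^T)); split.
  - exact: row_base_free.
  - by apply/sub_kermxP; rewrite eq_row_base.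
  - by rewrite mxrank_ker mxrank_tr natrB // rank_leq_col.
pose Q := N *m N^T.
have uQ : Q \in unitmx by apply: gram_unit.
have QT : Q^T = Q by rewrite /Q trmx_mul trmxK.
exists (N^T *m invmx Q *m N); split.
- by rewrite !trmx_mul trmxK trmx_inv QT mulmxA.
- rewrite -!mulmxA; congr (_ *m (_ *m _)).
  by rewrite !mulmxA -/Q mulmxV // mul1mx.
- by rewrite !mulmxA -[B]trmxK -trmx_mul NB trmx0 !mul0mx.
- by rewrite mxtrace_mulC mulmxA -/Q mulmxV // mxtrace1.
Qed.

(** The diagonal of the projection [P] lies in [[0, 1]] and sums to the dimension of the kernel.
    Were its entries on [J] all below [e], the sum would be less than [e * n + #|~: J|]. The witness
    [u] is column [j] of [P], and [P^T = P = P *m P] gives [P j j = |u|^2]. *)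
Lemma kernel_vector_peaked m n (B : 'M[R]_(m, n)) (J : {set 'I_n}) (e : R) :
  0 < e -> (0 < n)%N ->
  e * n%:R <= n%:R - (\rank B)%:R - #|~: J|%:R ->
  exists j (u : 'cV[R]_n), [/\ j \in J, B *m u = 0, u j 0 = sqn u & e <= sqn u].
Proof.
move=> e0 n0 hJ; have [P [PT PP BP trP]] := kernel_projection B.
have Pdiag j : P j j = sqn (col j P).
  rewrite -{1}PP mxE; apply: eq_bigr => i _.
  by rewrite -{1}PT !mxE expr2.
have Ple1 j : P j j <= 1.
  have P0 : 0 <= P j j by rewrite Pdiag sqn_ge0.
  have : P j j ^+ 2 <= P j j.
    rewrite {2}Pdiag /sqn (bigD1 j) //= mxE lerDl.
    by apply: sumr_ge0 => i _; apply: sqr_ge0.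
  by nra.
case: (boolP [exists j in J, e <= P j j]).
  move=> /exists_inP [j jJ ej].
  exists j, (col j P); split => //.
  - by rewrite colE mulmxA BP mul0mx.
  - by rewrite -Pdiag mxE.
  - by rewrite -Pdiag.
move=> /exists_inPn hN; exfalso; move: hJ; rewrite -trP /mxtrace.
have -> : #|~: J|%:R = \sum_(i in ~: J) (1 : R) by rewrite -sum1_card natr_sum.
rewrite (bigID (fun i => i \in J)) /=.
have hC : \sum_(i | i \notin J) P i i <= \sum_(i in ~: J) 1.
  under [leRHS]eq_bigl do rewrite inE.
  by apply: ler_sum.
(* Strictness needs an element of [J]; for empty [J] the trace is at most [#|~: J|], against
   [0 < e * n]. *)
have [j0 j0J | J0] := pickP (mem J); last first.
  rewrite (big_pred0 _ _ _ _ (fun i => J0 i)) => h.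
  have : 0 < e * n%:R by rewrite mulr_gt0 ?ltr0n.
  by lra.
have hS : \sum_(i in J) P i i < \sum_(i in J) e.
  apply: ltr_sum => [|i iJ].
    by apply/hasP; exists j0; rewrite ?mem_index_enum.
  by rewrite ltNge; apply: hN.
have hS2 : \sum_(i in J) e <= e * n%:R.
  rewrite sumr_const -[e *+ _]mulr_natr ler_wpM2l ?ler_nat ?(ltW e0) //.
  by rewrite -[X in (_ <= X)%N]card_ord max_card.
by lra.
Qed.

(** * Tools for the descent: Markov's inequality, one step, iteration, choice of columns *)

Lemma markov_sum (I : finType) (f : I -> R) (a : R) : (forall i, 0 <= f i) ->
  0 < a -> \sum_i f i <= a -> #|[set i | 1 < f i]|%:R <= a.
Proof.
move=> f0 a0; apply: le_trans.
rewrite -sum1_card natr_sum big_mkcond /=; apply: ler_sum => i _.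
by rewrite inE; case: ifP => [/ltW|].
Qed.

(* If [z] is compressible then [|z|^2 = <B x, B z> <= sqrt lam |B x| |z|];
   otherwise [|z|] is negligible compared with its l1 norm. *)
Lemma gradient_step m n (B : 'M[R]_(m, n)) (x : 'cV[R]_n) (lam kap k e : R) :
  let z := B^T *m (B *m x) in
  0 < lam -> 0 < k ->
  (l1norm z ^+ 2 <= k * sqn z -> sqn (B *m z) <= lam * sqn z) ->
  kap * sqn x - e <= sqn (B *m x) ->
  sqn (x - lam^-1 *: z) <=
    (1 - kap / lam) * sqn x + lam^-1 * e + (lam^-1 * l1norm z) ^+ 2 / k.
Proof.
move=> z lam0 k0 hz hx.
have dxz : dot x z = sqn (B *m x) by rewrite /z -dot_mulmx dotxx.
have dz : dot (B *m x) (B *m z) = sqn z.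
  by rewrite dotC dot_mulmx -/z dotxx.
have b0 : 0 < lam^-1 by rewrite invr_gt0.
have -> : sqn (x - lam^-1 *: z) =
    sqn x - 2 * lam^-1 * sqn (B *m x) + lam^-1 ^+ 2 * sqn z.
  rewrite -dxz -[in LHS](scale1r x) sqn_subscale; ring.
have key : lam^-1 ^+ 2 * sqn z <=
    lam^-1 * sqn (B *m x) + (lam^-1 * l1norm z) ^+ 2 / k.
  have [cz|icz] := lerP (l1norm z ^+ 2) (k * sqn z).
    have h := hz cz.
    have : 0 <= sqn (lam *: (B *m x) - 1 *: (B *m z)) by exact: sqn_ge0.
    rewrite sqn_subscale dz => h2.
    have h3 : lam * sqn z <= lam * (lam * sqn (B *m x)) by nra.
    rewrite ler_pM2l // in h3.
    have h4 : lam^-1 ^+ 2 * sqn z <= lam^-1 ^+ 2 * (lam * sqn (B *m x)).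
      by rewrite ler_pM2l // exprn_gt0.
    have -> : lam^-1 * sqn (B *m x) = lam^-1 ^+ 2 * (lam * sqn (B *m x)).
      by field; rewrite gt_eqF.
    apply: (le_trans h4); rewrite lerDl divr_ge0 ?sqr_ge0 ?(ltW k0) //.
  rewrite exprMn -[in leRHS]mulrA.
  have h4 : lam^-1 ^+ 2 * sqn z <= lam^-1 ^+ 2 * (l1norm z ^+ 2 / k).
    by rewrite ler_pM2l ?exprn_gt0 // ler_pdivlMr // mulrC ltW.
  by apply: (le_trans h4); rewrite lerDr mulr_ge0 ?sqn_ge0 ?(ltW b0).
have hx' : lam^-1 * (kap * sqn x - e) <= lam^-1 * sqn (B *m x).
  by rewrite ler_pM2l.
have -> : kap / lam = lam^-1 * kap by rewrite mulrC.
nra.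
Qed.

(** While the sequence stays above [lo], the error [e] is at most [q / 2 * a t], so half of the
    contraction survives each step. *)
Lemma iterated_contraction (a : nat -> R) (q e lo : R) (d : nat) :
  0 <= q -> e <= q / 2 * lo ->
  (forall t, (t <= d)%N -> lo <= a t) ->
  (forall t, (t < d)%N -> a t.+1 <= (1 - q) * a t + e) ->
  q <= 2 ->
  a d <= (1 - q / 2) ^+ d * a 0%N.
Proof.
move=> q0 he hlo hstep q2.
suff: forall t, (t <= d)%N -> a t <= (1 - q / 2) ^+ t * a 0%N by apply.
elim=> [_|t IH td]; first by rewrite expr0 mul1r.
have h1 := hstep _ td; have h2 := IH (ltnW td); have h3 := hlo _ (ltnW td).
have h4 : (1 - q / 2) * a t <= (1 - q / 2) * ((1 - q / 2) ^+ t * a 0%N).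
  by apply: ler_wpM2l => //; lra.
rewrite exprS -mulrA; apply: le_trans h4.
have : q / 2 * lo <= q / 2 * a t by apply: ler_wpM2l => //; lra.
by lra.
Qed.

(** Over all columns, the [l1] interactions sum to at most [L * F * n] and the masses on [G] to at
    most [th * F * n]. The thresholds are [4 / del] times these averages, so each condition accounts
    for a [del / 4] fraction of the columns. *)
Lemma column_selection m n (A : 'M[R]_(m, n)) (G : {set 'I_m})
    (F del L th : R) :
  0 < F -> 0 < del -> 0 < L -> 0 < th -> (0 < n)%N ->
  (forall i, i \notin G -> (\sum_j `|A i j|) ^+ 2 <= L * \sum_j A i j ^+ 2) ->
  \sum_i \sum_j A i j ^+ 2 <= F * n%:R ->
  \sum_(i in G) \sum_j A i j ^+ 2 <= th * F * n%:R ->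
  exists J : {set 'I_n}, [/\ #|~: J|%:R <= del / 2 * n%:R,
    forall l, l \in J ->
      \sum_(i | i \notin G) `|A i l| * (\sum_j `|A i j|) <= 4 * L * F / del &
    forall l, l \in J -> \sum_(i in G) A i l ^+ 2 <= 4 * th * F / del].
Proof.
move=> F0 del0 L0 th0 n0 hbad htot hgood.
pose w l := \sum_(i | i \notin G) `|A i l| * (\sum_j `|A i j|).
pose g l := \sum_(i in G) A i l ^+ 2.
pose M := 4 * L * F / del; pose gam := 4 * th * F / del.
have M0 : 0 < M by rewrite /M !mulr_gt0 ?invr_gt0 ?ltr0n.
have gam0 : 0 < gam by rewrite /gam !mulr_gt0 ?invr_gt0 ?ltr0n.
have w0 l : 0 <= w l.
  by apply: sumr_ge0 => i _; rewrite mulr_ge0 // sumr_ge0.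
have g0 l : 0 <= g l by apply: sumr_ge0 => i _; apply: sqr_ge0.
have sw : \sum_l w l <= L * F * n%:R.
  rewrite /w exchange_big /=.
  under eq_bigr do rewrite -mulr_suml -expr2.
  apply: (@le_trans _ _ (\sum_(i | i \notin G) L * \sum_j A i j ^+ 2)).
    exact: ler_sum.
  rewrite -mulr_sumr -[leRHS]mulrA; apply: ler_wpM2l; first exact: ltW.
  apply: le_trans htot; rewrite [leRHS](bigID (fun i => i \in G)) /= lerDr.
  by do 2!(apply: sumr_ge0 => ? _); apply: sqr_ge0.
have sg : \sum_l g l <= th * F * n%:R by rewrite /g exchange_big.
(* Adding both loads in units of their thresholds lets a single use of Markov's inequality treat
   them together. *)
exists [set l | w l / M + g l / gam <= 1]; split.
- rewrite (_ : ~: _ = [set l | 1 < w l / M + g l / gam]); last first.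
    by apply/setP => l; rewrite !inE ltNge.
  apply: markov_sum => [l||].
  + by rewrite addr_ge0 // divr_ge0 // ltW.
  + by rewrite !mulr_gt0 ?invr_gt0 ?ltr0n.
  rewrite big_split /= -!mulr_suml.
  have h1 : (\sum_l w l) / M <= del / 4 * n%:R.
    rewrite ler_pdivrMr // (le_trans sw) // /M le_eqVlt; apply/orP; left.
    by apply/eqP; field; rewrite gt_eqF.
  have h2 : (\sum_l g l) / gam <= del / 4 * n%:R.
    rewrite ler_pdivrMr // (le_trans sg) // /gam le_eqVlt; apply/orP; left.
    by apply/eqP; field; rewrite gt_eqF.
  by lra.
- move=> l; rewrite inE => h.
  rewrite -/(w l) -/M -[leRHS]mul1r -ler_pdivrMr //; apply: le_trans h.
  by rewrite lerDl divr_ge0 // ltW.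
- move=> l; rewrite inE => h.
  rewrite -/(g l) -/gam -[leRHS]mul1r -ler_pdivrMr //; apply: le_trans h.
  by rewrite lerDr divr_ge0 // ltW.
Qed.

(** * Zeroing the discarded rows and columns *)

Section Masked.
Variables (m n : nat) (A : 'M[R]_(m, n)) (G : {set 'I_m}) (J : {set 'I_n}).

(** Entries are zeroed instead of removed, so that vectors stay in the space where the ARIP of [A]
    applies. *)
Definition masked : 'M[R]_(m, n) :=
  \matrix_(i, j) if (i \notin G) && (j \in J) then A i j else 0.

Lemma rank_masked : (\rank masked <= \rank A)%N.
Proof.
have -> : masked = diag_mx (\row_i (i \notin G)%:R) *m A
                   *m diag_mx (\row_j (j \in J)%:R).
  apply/matrixP => i j; rewrite mul_mx_diag mul_diag_mx !mxE.
  case: (i \notin G); case: (j \in J);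
    by rewrite /= ?(mul0r, mulr0, mul1r, mulr1).
exact: leq_trans (mxrankM_maxl _ _) (mxrankM_maxr _ _).
Qed.

Lemma masked_gram_supp (y : 'cV[R]_m) j : j \notin J -> (masked^T *m y) j 0 = 0.
Proof.
move=> jJ; rewrite mxE big1 // => i _.
by rewrite !mxE (negbTE jJ) andbF mul0r.
Qed.

Lemma masked_mulE (x : 'cV[R]_n) i : (forall j, j \notin J -> x j 0 = 0) ->
  (masked *m x) i 0 = if i \in G then 0 else (A *m x) i 0.
Proof.
move=> xJ; rewrite !mxE; case: ifP => iG.
  by rewrite big1 // => j _; rewrite mxE iG /= mul0r.
apply: eq_bigr => j _; rewrite mxE iG /=; case: ifPn => // jJ.
by rewrite xJ // !mulr0.
Qed.

Lemma sqn_masked (x : 'cV[R]_n) : (forall j, j \notin J -> x j 0 = 0) ->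
  sqn (A *m x) = sqn (masked *m x) + \sum_(i in G) (A *m x) i 0 ^+ 2.
Proof.
move=> xJ; rewrite addrC /sqn (bigID (fun i => i \in G)) /=; congr (_ + _).
rewrite [RHS](bigID (fun i => i \in G)) /= [X in _ = X + _]big1 ?add0r.
  by apply: eq_bigr => i iG; rewrite masked_mulE // (negbTE iG).
by move=> i iG; rewrite masked_mulE // iG expr0n.
Qed.

Lemma masked_col_weight (M : R) : 0 <= M ->
  (forall l, l \in J ->
     \sum_(i | i \notin G) `|A i l| * (\sum_j `|A i j|) <= M) ->
  forall l, \sum_i `|masked i l| * (\sum_j `|masked i j|) <= M.
Proof.
move=> M0 hM l; case: (boolP (l \in J)) => lJ; last first.
  by rewrite big1 // => i _; rewrite mxE (negbTE lJ) andbF normr0 mul0r.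
apply: le_trans (hM l lJ); rewrite [leRHS]big_mkcond /=; apply: ler_sum => i _.
rewrite mxE lJ andbT; case: ifP => iG; last by rewrite normr0 mul0r.
apply: ler_wpM2l => //; apply: ler_sum => j _; rewrite mxE.
by case: ifP => //; rewrite normr0.
Qed.

End Masked.

(** * The descent *)

(** The factor [1 + 4 * L / del] bounds the growth of the [l1] norm in one step; the exponent is
    doubled because that norm is squared. The last hypothesis keeps the iterates in the range of the
    ARIP and the error of a step at most [del / (4 * D ^+ 2)], which is half of the contraction
    [1 / D ^+ 2] times the floor [del / 2] of [|x|^2]. The conclusion compares this floor with the
    contracted norm after [d] steps. *)
Lemma compressible_rows_descent m n (A : 'M[R]_(m, n)) (G : {set 'I_m})
    (kap D k del L th : R) (d : nat) :
  (0 < n)%N -> 0 < kap -> 1 <= D -> 0 < k -> 0 < del -> 0 < L -> 0 < th ->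
  (forall x : 'cV[R]_n, l1norm x ^+ 2 <= k * sqn x ->
    kap * sqn x <= sqn (A *m x) <= D ^+ 2 * kap * sqn x) ->
  (\rank A)%:R = (1 - del) * n%:R ->
  (forall i, i \notin G -> (\sum_j `|A i j|) ^+ 2 <= L * \sum_j A i j ^+ 2) ->
  \sum_i \sum_j A i j ^+ 2 <= D ^+ 2 * kap * n%:R ->
  \sum_(i in G) \sum_j A i j ^+ 2 <= th * (D ^+ 2 * kap) * n%:R ->
  (1 + 4 * L / del) ^+ d.*2 * (4 * th / del + k^-1) <= del / (4 * D ^+ 2) ->
  del / 2 <= (1 - (2 * D ^+ 2)^-1) ^+ d.
Proof.
move=> n0 kap0 D1 k0 del0 L0 th0 arip rkA hbad htot hgood hE.
pose lam := D ^+ 2 * kap; pose E := 1 + 4 * L / del.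
have D0 : 0 < D by lra.
have D20 : 0 < D ^+ 2 by rewrite exprn_gt0.
have lam0 : 0 < lam by rewrite mulr_gt0.
have [J [cJ wJ gJ]] :=
  column_selection lam0 del0 L0 th0 n0 hbad htot hgood.
pose B := masked A G J.
pose M := 4 * L * lam / del; pose gam := 4 * th * lam / del.
have M0 : 0 <= M by rewrite /M ltW // !mulr_gt0 ?invr_gt0 ?ltr0n.
have gam0 : 0 <= gam by rewrite /gam ltW // !mulr_gt0 ?invr_gt0 ?ltr0n.
have hM : forall l, \sum_i `|B i l| * (\sum_j `|B i j|) <= M.
  exact: masked_col_weight.
have ME : lam^-1 * M = 4 * L / del by rewrite /M; field; rewrite !gt_eqF.
have LD0 : 0 < 4 * L / del by rewrite !mulr_gt0 ?invr_gt0 ?ltr0n.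
have E1 : 1 <= E by rewrite /E lerDl ltW.
(* The kernel of [B] has dimension at least [del * n] and [J] misses at most [del / 2 * n] columns,
   which leaves [del / 2]. *)
have [j [u [jJ Bu uj hu]]] : exists j (u : 'cV[R]_n),
    [/\ j \in J, B *m u = 0, u j 0 = sqn u & del / 2 <= sqn u].
  apply: kernel_vector_peaked => //; first by lra.
  have : (\rank B)%:R <= (\rank A)%:R :> R by rewrite ler_nat rank_masked.
  by lra.
pose x t : 'cV[R]_n :=
  iter t (fun y => y - lam^-1 *: (B^T *m (B *m y))) (delta_mx j 0).
have xS t : x t.+1 = x t - lam^-1 *: (B^T *m (B *m x t)) by [].
have xJ t l : l \notin J -> x t l 0 = 0.
  move=> lJ; elim: t => [|t IH].
    by rewrite /x /= mxE; case: eqP => // lj; rewrite lj jJ in lJ.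
  by rewrite xS mxE IH mxE [X in - X]mxE masked_gram_supp // mulr0 subr0.
have xl1 t : l1norm (x t) <= E ^+ t.
  elim: t => [|t IH].
    by rewrite expr0 /x /= l1norm_delta.
  rewrite xS (le_trans (l1norm_sub_scale _ _ _)) ?invr_ge0 ?(ltW lam0) //.
  have h : lam^-1 * l1norm (B^T *m (B *m x t)) <= lam^-1 * (M * l1norm (x t)).
    by apply: ler_wpM2l; rewrite ?invr_ge0 ?(ltW lam0) //; apply: l1norm_gram.
  rewrite mulrA ME in h.
  apply: (@le_trans _ _ (E * l1norm (x t))); first by rewrite /E; lra.
  by rewrite exprS ler_wpM2l // (le_trans _ E1).
(* Each step moves within the range of [B^T], which is orthogonal to [u], so the inner product keeps
   its initial value [u j 0]. *)
have xu t : dot (x t) u = sqn u.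
  elim: t => [|t IH].
    rewrite -uj /dot (bigD1 j) //= big1 => [|i ij].
      by rewrite addr0 mxE !eqxx mul1r.
    by rewrite mxE (negbTE ij) mul0r.
  rewrite xS -IH.
  have -> : dot (x t - lam^-1 *: (B^T *m (B *m x t))) u =
      dot (x t) u - lam^-1 * dot (B^T *m (B *m x t)) u.
    rewrite /dot mulr_sumr -sumrB; apply: eq_bigr => i _.
    by rewrite mxE [in X in _ + X]mxE [X in - X]mxE mulrBl mulrA.
  rewrite dot_mulmx trmxK Bu [dot _ 0]big1 ?mulr0 ?subr0 // => i _.
  by rewrite [X in _ * X]mxE mulr0.
(* From [|x t - u|^2 >= 0] and [dot (x t) u = |u|^2]. *)
have xlo t : del / 2 <= sqn (x t).
  apply: (le_trans hu).
  have : 0 <= sqn (1 *: x t - 1 *: u) by exact: sqn_ge0.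
  by rewrite sqn_subscale xu; lra.
have x0 : sqn (x 0%N) = 1 by exact: sqn_delta.
have l1sq t : (t <= d)%N -> l1norm (x t) ^+ 2 <= E ^+ d.*2.
  move=> td; apply: (@le_trans _ _ (E ^+ t ^+ 2)).
    by rewrite lerXn2r ?nnegrE ?l1norm_ge0 // exprn_ge0 // (le_trans _ E1).
  by rewrite -exprM muln2 ler_weXn2l // leq_double.
have k10 : 0 < k^-1 by rewrite invr_gt0.
have td0 : 0 < 4 * th / del by rewrite !mulr_gt0 ?invr_gt0 ?ltr0n.
have E20 : 0 < E ^+ d.*2 by rewrite exprn_gt0 // (lt_le_trans _ E1).
have delD : del / (4 * D ^+ 2) <= del / 4.
  rewrite ler_pM2l // lef_pV2 ?posrE ?mulr_gt0 ?ltr0n //.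
  have : 1 <= D ^+ 2 by rewrite expr_ge1 // ltW.
  by lra.
have Ek : E ^+ d.*2 <= k * (del / 2).
  rewrite mulrC -ler_pdivrMr //.
  have : E ^+ d.*2 * k^-1 <= E ^+ d.*2 * (4 * th / del + k^-1).
    by rewrite ler_pM2l // lerDr ltW.
  by move=> h; have := le_trans h (le_trans hE delD); lra.
have xcomp t : (t <= d)%N -> l1norm (x t) ^+ 2 <= k * sqn (x t).
  move=> td; apply: (le_trans (l1sq _ td)); apply: (le_trans Ek).
  by rewrite ler_pM2l.
have step t : (t < d)%N ->
    sqn (x t.+1) <= (1 - (D ^+ 2)^-1) * sqn (x t) + del / (4 * D ^+ 2).
  move=> td.
  have /andP[lowA _] := arip _ (xcomp _ (ltnW td)).
  (* Passing from [A] to [B] loses the rows in [G], whose share is small because [x t] is supported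
     on [J]. *)
  have lowB : kap * sqn (x t) - gam * E ^+ d.*2 <= sqn (B *m x t).
    have hG : \sum_(i in G) (A *m x t) i 0 ^+ 2 <= gam * E ^+ d.*2.
      apply: (@le_trans _ _ (gam * l1norm (x t) ^+ 2)).
        apply: sqn_mulmx_le_l1norm => l xl; apply: gJ.
        by apply: contraNT xl => lJ; rewrite xJ.
      by apply: ler_wpM2l => //; apply/l1sq/ltnW.
    by have := sqn_masked A G (xJ t); rewrite -/B; lra.
  have upB : let z := B^T *m (B *m x t) in
      l1norm z ^+ 2 <= k * sqn z -> sqn (B *m z) <= lam * sqn z.
    move=> z cz; have /andP[_ up] := arip _ cz.
    apply: le_trans up; rewrite (@sqn_masked _ _ A G J z) => [|l lJ].
      by rewrite lerDl sumr_ge0 // => i _; apply: sqr_ge0.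
    exact: masked_gram_supp.
  have := gradient_step lam0 k0 upB lowB; rewrite -xS => /le_trans; apply.
  have -> : kap / lam = (D ^+ 2)^-1 by rewrite /lam; field; rewrite !gt_eqF.
  rewrite -addrA lerD2l; apply: le_trans hE; rewrite mulrDr; apply: lerD.
    rewrite le_eqVlt; apply/orP; left; apply/eqP.
    by rewrite /gam -/E; field; rewrite !gt_eqF.
  apply: ler_wpM2r; first exact: ltW.
  have zl : lam^-1 * l1norm (B^T *m (B *m x t)) <= E ^+ t.+1.
    have h : lam^-1 * l1norm (B^T *m (B *m x t)) <= lam^-1 * (M * l1norm (x t)).
      by apply: ler_wpM2l; rewrite ?invr_ge0 ?(ltW lam0) //; apply: l1norm_gram.
    apply: (le_trans h); rewrite mulrA ME exprS.
    apply: ler_pM => //; rewrite ?l1norm_ge0 ?(ltW LD0) //.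
    by rewrite /E; lra.
  apply: (@le_trans _ _ (E ^+ t.+1 ^+ 2)).
    rewrite lerXn2r ?nnegrE //; last by rewrite exprn_ge0 // (le_trans _ E1).
    by rewrite mulr_ge0 ?l1norm_ge0 ?invr_ge0 ?(ltW lam0).
  by rewrite -exprM muln2 ler_weXn2l // leq_double.
have D21 : (D ^+ 2)^-1 <= 1 by rewrite invf_le1 // expr_ge1 // ltW.
have := @iterated_contraction (fun t => sqn (x t)) (D ^+ 2)^-1
  (del / (4 * D ^+ 2)) (del / 2) d.
rewrite x0 mulr1 => ic; apply: le_trans (xlo d) _.
have -> : (2 * D ^+ 2)^-1 = (D ^+ 2)^-1 / 2 by rewrite invfM mulrC.
apply: ic => //; first by rewrite invr_ge0 ltW.
- by rewrite le_eqVlt; apply/orP; left; apply/eqP; field; rewrite gt_eqF.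
- by lra.
Qed.

(** * Consequences of the ARIP for column and row masses *)

(** Squaring removes the roots: the condition on [Delta12] becomes [|x|_1^2 <= k |x|_2^2], [kap] is
    [K ^+ 2], and [x = 0] is allowed. *)
Lemma arip_sqr m n (k D : R) (A : 'M[R]_(m, n)) : 0 < k -> 0 <= D ->
  l2_ARIP k D A -> exists2 kap : R, 0 < kap &
  forall x : 'cV[R]_n, l1norm x ^+ 2 <= k * sqn x ->
    kap * sqn x <= sqn (A *m x) <= D ^+ 2 * kap * sqn x.
Proof.
move=> k0 D0 [K K0 arip]; exists (K ^+ 2); first by rewrite exprn_gt0.
move=> x hx; have [->|xn0] := eqVneq x 0.
  by rewrite mulmx0 !sqn0 !mulr0 lexx.
have sx : 0 < sqn x.
  rewrite lt_neqAle sqn_ge0 andbT eq_sym.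
  by apply: contra xn0 => /eqP /sqn_eq0 ->.
have l1x : 0 < l1norm x.
  rewrite lt_neqAle l1norm_ge0 andbT eq_sym; apply/eqP => l0.
  by have := sqn_le_l1norm x; rewrite l0 expr0n /= leNgt sx.
have l2ge0 p (y : 'cV[R]_p) : 0 <= l2norm y by apply: sqrtr_ge0.
have comp : Num.sqrt (n%:R / k) <= Delta12 x.
  rewrite /Delta12 sqrtrM ?ler0n // sqrtrV ?(ltW k0) // mulrC.
  rewrite mulrAC ler_wpM2r ?sqrtr_ge0 // ler_pdivlMr // mulrC.
  rewrite ler_pdivrMr ?sqrtr_gt0 //.
  rewrite -(@ler_pXn2r _ 2) ?nnegrE ?(ltW l1x) ?mulr_ge0 ?sqrtr_ge0 //.
  by rewrite exprMn l2norm_sqr sqr_sqrtr ?(ltW k0) // mulrC.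
have /andP[lo up] := arip x xn0 comp.
rewrite -!l2norm_sqr -!exprMn; apply/andP; split.
  by rewrite lerXn2r ?nnegrE ?mulr_ge0 ?(ltW K0).
by rewrite lerXn2r ?nnegrE ?mulr_ge0 ?(ltW K0).
Qed.

(** Coordinate vectors have equal [l1] and [l2] norms, so [1 <= k] places them in the range of the
    ARIP, which then bounds the mass of every column. *)
Lemma frobenius_mass m n (A : 'M[R]_(m, n)) (kap D k : R) : 1 <= k ->
  (forall x : 'cV[R]_n, l1norm x ^+ 2 <= k * sqn x ->
    kap * sqn x <= sqn (A *m x) <= D ^+ 2 * kap * sqn x) ->
  kap * n%:R <= \sum_i \sum_j A i j ^+ 2 <= D ^+ 2 * kap * n%:R.
Proof.
move=> k1 arip.
have hcol j : kap <= \sum_i A i j ^+ 2 <= D ^+ 2 * kap.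
  have := arip (delta_mx j 0).
  rewrite sqn_delta l1norm_delta expr1n !mulr1 -colE.
  move=> /(_ k1).
  by rewrite {1 2}/sqn; under eq_bigr do rewrite mxE.
rewrite exchange_big /=.
have cst (a : R) : a * n%:R = \sum_(j < n) a.
  by rewrite sumr_const card_ord mulr_natr.
rewrite !cst; apply/andP; split; apply: ler_sum => j _;
  by have /andP[] := hcol j.
Qed.

(** Let [p] be the integer part of [k] and [x] the row restricted to a block of at most [p]
    coordinates. The ARIP applies to [x], and [(A x)_i = |x|^2], so [|x|^4 <= D^2 kap |x|^2]. At
    most [n / p + 1] blocks cover the row; [k <= 2 p] and [p <= n] then give the factor 4. *)
Lemma row_mass m n (A : 'M[R]_(m, n)) (kap D k : R) (i : 'I_m) :
  0 < kap -> 1 <= k -> k <= n%:R ->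
  (forall x : 'cV[R]_n, l1norm x ^+ 2 <= k * sqn x ->
    kap * sqn x <= sqn (A *m x) <= D ^+ 2 * kap * sqn x) ->
  k * \sum_j A i j ^+ 2 <= 4 * n%:R * (D ^+ 2 * kap).
Proof.
move=> kap0 k1 kn arip.
have k0 : 0 <= k by lra.
have /andP[pk kp] := truncn_itv k0; set p := Num.truncn k in pk kp.
have p0 : (0 < p)%N.
  by rewrite lt0n; apply/eqP => pz; rewrite pz in kp; lra.
have p1 : 1 <= p%:R :> R by rewrite ler1n.
have block b : \sum_(j < n | (j %/ p == b)%N) A i j ^+ 2 <= D ^+ 2 * kap.
  pose x : 'cV[R]_n := \col_j if (j %/ p == b)%N then A i j else 0.
  have sx : sqn x = \sum_(j < n | (j %/ p == b)%N) A i j ^+ 2.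
    rewrite /sqn [RHS]big_mkcond; apply: eq_bigr => j _; rewrite mxE.
    by case: ifP => // _; rewrite expr0n.
  have Ax : (A *m x) i 0 = sqn x.
    rewrite sx mxE [RHS]big_mkcond; apply: eq_bigr => j _; rewrite mxE.
    by case: ifP => _; rewrite ?mulr0 ?expr2.
  have cS : (#|[set j : 'I_n | (j %/ p == b)%N]| <= p)%N.
    rewrite -[leqRHS]card_ord.
    apply: (@leq_card_in _ _ (fun j : 'I_n => Ordinal (ltn_pmod j p0))).
    move=> j1 j2; rewrite !inE => /eqP e1 /eqP e2 /(congr1 val) /= e.
    by apply: val_inj => /=; rewrite (divn_eq j1 p) (divn_eq j2 p) e1 e2 e.
  have comp : l1norm x ^+ 2 <= k * sqn x.
    apply: (@le_trans _ _ (#|[set j : 'I_n | (j %/ p == b)%N]|%:R * sqn x)).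
      by apply: l1norm_sparse => j; rewrite inE mxE => /negbTE ->.
    apply: ler_wpM2r; first exact: sqn_ge0.
    by apply: le_trans pk; rewrite ler_nat.
  have /andP[_ up] := arip _ comp; rewrite -sx.
  have h : sqn x ^+ 2 <= sqn (A *m x).
    by rewrite -Ax [leRHS](bigD1 i) //= lerDl sumr_ge0 // => *; apply: sqr_ge0.
  have [s0|s0] := eqVneq (sqn x) 0.
    by rewrite s0 mulr_ge0 ?sqr_ge0 // ltW.
  have sx0 : 0 < sqn x by rewrite lt_neqAle eq_sym s0 sqn_ge0.
  by rewrite -(ler_pM2r sx0) -expr2 (le_trans h).
pose q := (n %/ p)%N.
have tot : \sum_j A i j ^+ 2 <= (q%:R + 1) * (D ^+ 2 * kap).
  have jq (j : 'I_n) : (j %/ p < q.+1)%N by rewrite ltnS leq_div2r // ltnW.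
  rewrite (partition_big (fun j : 'I_n => Ordinal (jq j)) predT) //=.
  apply: (@le_trans _ _ (\sum_(b < q.+1) D ^+ 2 * kap)).
    by apply: ler_sum => b _; exact: block b.
  by rewrite sumr_const card_ord -[leLHS]mulr_natl natr1.
have qp : q%:R * p%:R <= n%:R :> R by rewrite -natrM ler_nat leq_trunc_div.
have F0 : 0 <= D ^+ 2 * kap by rewrite mulr_ge0 ?sqr_ge0 // ltW.
apply: (@le_trans _ _ (k * ((q%:R + 1) * (D ^+ 2 * kap)))).
  exact: ler_wpM2l.
rewrite mulrA; apply: ler_wpM2r => //.
have q0 : 0 <= q%:R :> R by rewrite ler0n.
have k2 : k <= 2 * p%:R by move: kp; rewrite -natr1; lra.
apply: (@le_trans _ _ (2 * p%:R * (q%:R + 1))).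
  by apply: ler_wpM2r => //; lra.
by nra.
Qed.

(** * Spread vectors against sparse approximation *)

(** Split [x] along the support of [y]. The part on it has squared [l1] norm at most [s |x|^2]. The
    part off it is no longer than [x - y], so a small distance would give it the same [l1] bound,
    and then [|x|_1^2 <= 4 s |x|^2 <= L |x|^2]. *)
Lemma spread_far_from_sparse n (L s : R) (x : 'cV[R]_n) :
  (0 < n)%N -> 0 <= s -> 4 * s <= L -> L * sqn x < l1norm x ^+ 2 ->
  far_from_sparse (Num.sqrt (s / n%:R)) s x.
Proof.
move=> n0 s0 sL hx y ys.
have nR : 0 < n%:R :> R by rewrite ltr0n.
pose S := [set i | y i 0 != 0].
pose x1 : 'cV[R]_n := \col_i if i \in S then x i 0 else 0.
pose x2 : 'cV[R]_n := \col_i if i \in S then 0 else x i 0.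
have l1E : l1norm x = l1norm x1 + l1norm x2.
  rewrite /l1norm -big_split /=; apply: eq_bigr => i _; rewrite !mxE.
  by case: ifP => _; rewrite normr0 ?addr0 ?add0r.
have sx1 : sqn x1 <= sqn x.
  apply: ler_sum => i _; rewrite mxE; case: ifP => // _.
  by rewrite expr0n sqr_ge0.
have sx2 : sqn x2 <= sqn (x - y).
  apply: ler_sum => i _; rewrite !mxE inE; case: eqP => [->|_] /=.
    by rewrite subr0.
  by rewrite expr0n sqr_ge0.
have h1 : l1norm x1 ^+ 2 <= s * sqn x.
  apply: (@le_trans _ _ (#|S|%:R * sqn x1)).
    by apply: l1norm_sparse => i; rewrite mxE => /negbTE ->.
  by apply: ler_pM; rewrite ?ler0n ?sqn_ge0.
have h2 : l1norm x2 ^+ 2 <= n%:R * sqn x2.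
  have := @l1norm_sparse n x2 setT; rewrite cardsT card_ord; apply.
  by move=> i; rewrite inE.
have key : s * sqn x < n%:R * sqn (x - y).
  rewrite ltNge; apply/negP => h.
  have h3 : l1norm x2 ^+ 2 <= s * sqn x.
    by apply: (le_trans h2); apply: le_trans h; rewrite ler_pM2l.
  have : 4 * (s * sqn x) <= L * sqn x.
    by rewrite mulrA ler_wpM2r ?sqn_ge0.
  move: hx; rewrite l1E.
  have : 0 <= (l1norm x1 - l1norm x2) ^+ 2 by apply: sqr_ge0.
  by nra.
rewrite -(@ltr_pXn2r _ 2) ?nnegrE ?mulr_ge0 ?sqrtr_ge0 //.
rewrite exprMn !l2norm_sqr sqr_sqrtr ?divr_ge0 ?ler0n //.
by rewrite mulrAC ltr_pdivrMr // [ltRHS]mulrC.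
Qed.

(** * Exponential estimates for the choice of parameters *)

Lemma expR_ge_self (x : R) : x <= expR x.
Proof. by apply: le_trans (expR_ge1Dx x); lra. Qed.

(* In the next three lemmas [q] stands for [(1 - alpha)^(-1/4)], [Y] for
   [eta ln n] and [v^2] for [Y sqrt(1 - alpha) / D^3]. *)
Lemma descent_length (D q : R) : 1 <= D -> 1 <= q ->
  exists2 d : nat, d%:R <= 9 * (D ^+ 2 * q) &
    (1 - (2 * D ^+ 2)^-1) ^+ d < q ^- 4 / 2.
Proof.
move=> D1 q1.
have D20 : 1 <= D ^+ 2 by rewrite expr_ge1 //; lra.
have Dq1 : 1 <= D ^+ 2 * q by nra.
have Dq0 : 0 <= 8 * (D ^+ 2 * q) by lra.
have /andP[pk kp] := truncn_itv Dq0.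
(* With [d = p + 1] the quotient [d / (2 D^2)] exceeds [4 q], and [exp (2 q) >= 2 q^2] gives
   [exp (- 4 q) <= q^-4 / 2]. *)
set p := Num.truncn _ in pk kp; exists p.+1.
  by rewrite -natr1; lra.
pose b := (2 * D ^+ 2)^-1.
have b0 : 0 < b by rewrite invr_gt0; lra.
have b1 : b <= 1 by rewrite invf_le1; lra.
have q0 : 0 < q by lra.
have q40 : 0 < q ^+ 4 by rewrite exprn_gt0.
have h1 : (1 - b) ^+ p.+1 <= expR (- b) ^+ p.+1.
  rewrite lerXn2r ?nnegrE ?expR_ge0 //; first by lra.
  exact: expR_ge1Dx.
apply: (le_lt_trans h1); rewrite -expRM_natr.
have h2 : 4 * q < b * p.+1%:R.
  have -> : 4 * q = b * (8 * (D ^+ 2 * q)).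
    by rewrite /b; field; rewrite gt_eqF //; lra.
  by rewrite ltr_pM2l.
apply: (@lt_le_trans _ _ (expR (- (4 * q)))).
  by rewrite ltr_expR mulNr ltrN2.
rewrite expRN -invfM lef_pV2 ?posrE ?expR_gt0 ?mulr_gt0 ?ltr0n //.
have -> : 4 * q = 2 * (2 * q) by ring.
rewrite (expRM_natl 2).
have h3 : 2 * q ^+ 2 <= expR (2 * q).
  have q20 : 0 <= 2 * q by lra.
  have := expR_ge1Dxn 1 q20; rewrite (_ : 2`!%N = 2%N) //.
  by nra.
apply: (@le_trans _ _ ((2 * q ^+ 2) ^+ 2)); last first.
  by rewrite lerXn2r ?nnegrE ?expR_ge0 // mulr_ge0 ?sqr_ge0.
by rewrite exprMn -exprM; lra.
Qed.

Lemma growth_bound (D q v Y E : R) (d : nat) : 1 <= D -> 1 <= q -> 480 <= v ->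
  Y = v ^+ 2 * D ^+ 3 * q ^+ 2 ->
  d%:R <= 9 * (D ^+ 2 * q) ->
  0 <= E -> E <= v ^+ 2 * q ^+ 4 ->
  E ^+ d.*2 <= expR (Y / 4).
Proof.
move=> D1 q1 v480 YE dle E0 Ele.
have hE : E <= expR (2 * v + 4 * q).
  apply: (le_trans Ele); rewrite expRD (expRM_natl 2) (expRM_natl 4).
  apply: ler_pM; rewrite ?exprn_ge0 ?lerXn2r ?nnegrE ?expR_ge0 ?expR_ge_self //;
  by lra.
apply: (@le_trans _ _ (expR (2 * v + 4 * q) ^+ d.*2)).
  by rewrite lerXn2r ?nnegrE ?expR_ge0.
rewrite -expRM_natr ler_expR -mul2n natrM.
have D2 : 1 <= D ^+ 2 by rewrite expr_ge1 //; lra.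
have h1 : 2 * v + 4 * q <= 6 * (v * q) by nra.
have vq : 0 <= 6 * (v * q) by rewrite !mulr_ge0 //; lra.
apply: (@le_trans _ _ (6 * (v * q) * (2 * (9 * (D ^+ 2 * q))))).
  apply: ler_pM => //; rewrite ?mulr_ge0 ?ler0n //; first by lra.
  by rewrite ler_pM2l.
have X0 : 0 <= v * q ^+ 2 * D ^+ 2.
  by rewrite !mulr_ge0 ?sqr_ge0 //; lra.
(* Comparing [108 v q^2 D^2] with [Y / 4] reduces to [432 <= v D], which [480 <= v] supplies. *)
have -> : Y / 4 = (v * q ^+ 2 * D ^+ 2) * (v * D / 4) by rewrite YE; ring.
have -> : 6 * (v * q) * (2 * (9 * (D ^+ 2 * q))) =
    (v * q ^+ 2 * D ^+ 2) * 108 by ring.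
by apply: ler_wpM2l => //; nra.
Qed.

Lemma polynomial_bound (D q v Y : R) : 1 <= D -> 1 <= q -> 480 <= v ->
  Y = v ^+ 2 * D ^+ 3 * q ^+ 2 ->
  20 * D ^+ 2 * q ^+ 8 <= expR (Y / 4).
Proof.
move=> D1 q1 v480 YE.
have D0 : 0 <= D by lra.
have q0 : 0 <= q by lra.
apply: (@le_trans _ _ (expR (5 + 2 * D + 8 * q))).
  rewrite expRD [expR (5 + _)]expRD (expRM_natl 2) (expRM_natl 8).
  have h5 : 20 <= expR 5 :> R.
    rewrite -[5]mulr1 (expRM_natl 5).
    apply: (@le_trans _ _ (2 ^+ 5)); first by rewrite -natrX ler_nat.
    rewrite lerXn2r ?nnegrE ?expR_ge0 //.
    by apply: le_trans (expR_ge1Dx 1); lra.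
  have hX (x : R) p : 0 <= x -> x ^+ p <= expR x ^+ p.
    by move=> x0; rewrite lerXn2r ?nnegrE ?expR_ge0 ?expR_ge_self.
  have D20 : 0 <= D ^+ 2 by exact: exprn_ge0.
  have q80 : 0 <= q ^+ 8 by exact: exprn_ge0.
  apply: (ler_pM _ q80 _ (hX q 8 q0)); first by rewrite mulr_ge0.
  by apply: (ler_pM _ D20 h5 (hX D 2 D0)).
rewrite ler_expR YE.
have D3 : D <= D ^+ 3 by rewrite ler_eXnr.
have q2 : q <= q ^+ 2 by rewrite ler_eXnr.
have v2 : 60 <= v ^+ 2 by nra.
have Dq : D * q <= D ^+ 3 * q ^+ 2 by apply: ler_pM => //; lra.
have Dq1 : D + q <= D * q + 1 by nra.
have : 60 * (D ^+ 3 * q ^+ 2) <= v ^+ 2 * (D ^+ 3 * q ^+ 2).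
  by apply: ler_wpM2r => //; nra.
nra.
Qed.

(** * Lower bound on the mass of the spread rows *)

(** By contradiction through the descent with [th = exp (- Y / 2)]. Of this gain, one factor
    [exp (Y / 4)] pays for the growth of the [l1] norm and another for the polynomial factor
    [20 D^2 q^8]; [d] is chosen so that the conclusion of the descent fails. *)
Lemma spread_rows_mass m n (A : 'M[R]_(m, n)) (kap D k del Y L : R) :
  let G := [set i | L * (\sum_j A i j ^+ 2) < (\sum_j `|A i j|) ^+ 2] in
  (0 < n)%N -> 0 < kap -> 1 <= D -> 1 <= k -> 0 < del -> del <= 1 -> 0 <= Y ->
  (forall x : 'cV[R]_n, l1norm x ^+ 2 <= k * sqn x ->
    kap * sqn x <= sqn (A *m x) <= D ^+ 2 * kap * sqn x) ->
  (\rank A)%:R = (1 - del) * n%:R ->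
  expR Y <= k ->
  L = Y * Num.sqrt del / D ^+ 3 / 480 ^+ 2 ->
  expR (- (Y / 2)) * (\sum_i \sum_j A i j ^+ 2) <=
    \sum_(i in G) \sum_j A i j ^+ 2.
Proof.
move=> G n0 kap0 D1 k1 del0 del1 Y0 arip rkA Yk LE.
have s0 (P : pred 'I_m) : 0 <= \sum_(i | P i) \sum_j A i j ^+ 2.
  by do 2!(apply: sumr_ge0 => ? _); apply: sqr_ge0.
(* For [L < 1], [|a|_2 <= |a|_1] forces a row that is not spread to vanish, so the spread rows carry
   all the mass. *)
have [L1|L1] := ltP L 1.
  have -> : \sum_(i in G) \sum_j A i j ^+ 2 = \sum_i \sum_j A i j ^+ 2.
    rewrite [RHS](bigID (fun i => i \in G)) /= [X in _ = _ + X]big1 ?addr0 //.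
    move=> i; rewrite inE -leNgt => hi.
    have h1 := sqn_le_l1norm (row i A)^T; have h2 := sqn_ge0 (row i A)^T.
    have E1 : sqn (row i A)^T = \sum_j A i j ^+ 2.
      by apply: eq_bigr => j _; rewrite !mxE.
    have E2 : l1norm (row i A)^T = \sum_j `|A i j|.
      by apply: eq_bigr => j _; rewrite !mxE.
    rewrite E1 E2 in h1 h2; apply/eqP; rewrite eq_le h2 andbT.
    by rewrite -(@pmulr_rle0 _ (1 - L)) ?subr_gt0 //; lra.
  rewrite -[leRHS]mul1r; apply: ler_wpM2r; first exact: s0.
  by rewrite -[leRHS]expR0 ler_expR; lra.
rewrite leNgt; apply/negP => hlt.
have D0 : 0 < D by lra.
have D20 : 0 < D ^+ 2 by rewrite exprn_gt0.
have D30 : 0 < D ^+ 3 by rewrite exprn_gt0.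
have k0 : 0 < k by lra.
pose th := expR (- (Y / 2)); have th0 : 0 < th by exact: expR_gt0.
have /andP[_ htot] := frobenius_mass k1 arip.
have hgood : \sum_(i in G) \sum_j A i j ^+ 2 <= th * (D ^+ 2 * kap) * n%:R.
  by apply: (le_trans (ltW hlt)); rewrite -[leRHS]mulrA ler_pM2l.
have hbad i : i \notin G -> (\sum_j `|A i j|) ^+ 2 <= L * \sum_j A i j ^+ 2.
  by rewrite inE -leNgt.
pose q := (Num.sqrt (Num.sqrt del))^-1.
have sd0 : 0 < Num.sqrt del by rewrite sqrtr_gt0.
have q0 : 0 < q by rewrite invr_gt0 sqrtr_gt0.
have q2 : q ^+ 2 = (Num.sqrt del)^-1 by rewrite exprVn sqr_sqrtr // ltW.
have q4 : q ^+ 4 = del^-1.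
  by rewrite (exprM q 2 2) q2 exprVn sqr_sqrtr // ltW.
have q1 : 1 <= q.
  have : 1 <= q ^+ 4 by rewrite q4 invf_ge1.
  by rewrite expr_ge1 // ltW.
pose u := Y * Num.sqrt del / D ^+ 3; pose v := Num.sqrt u.
(* This is [1 <= L] rewritten; it yields the lower bound on [v] that the estimates require. *)
have u480 : 480 ^+ 2 <= u.
  by move: L1; rewrite LE -/u ler_pdivlMr ?mul1r // exprn_gt0 // ltr0n.
have v2 : v ^+ 2 = u.
  by rewrite sqr_sqrtr // (le_trans _ u480) // exprn_ge0 // ler0n.
have v480 : 480 <= v.
  by rewrite -(@ler_pXn2r _ 2) ?nnegrE ?sqrtr_ge0 ?ler0n // v2.
have YE : Y = v ^+ 2 * D ^+ 3 * q ^+ 2.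
  by rewrite v2 /u q2; field; rewrite !gt_eqF.
have [d dle dlt] := descent_length D1 q1.
have q40 : 0 < q ^+ 4 by rewrite exprn_gt0.
have q41 : 1 <= q ^+ 4 by rewrite expr_ge1 // ltW.
have growth : (1 + 4 * L / del) ^+ d.*2 <= expR (Y / 4).
  apply: (growth_bound D1 q1 v480 YE dle).
    by rewrite addr_ge0 // !mulr_ge0 ?invr_ge0 ?ler0n ?(ltW del0) //; lra.
  rewrite v2 -q4 LE -/u.
  have h : 2 <= u * q ^+ 4.
    by rewrite -[2]mulr1; apply: ler_pM => //; rewrite ?ler0n //; lra.
  have -> : 4 * (u / 480 ^+ 2) * q ^+ 4 = (4 / 480 ^+ 2) * (u * q ^+ 4).
    by ring.
  by lra.
have poly := polynomial_bound D1 q1 v480 YE.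
have : del / 2 <= (1 - (2 * D ^+ 2)^-1) ^+ d.
  apply: (compressible_rows_descent n0 kap0 D1 k0 del0 _ th0 arip rkA
    hbad htot hgood); first by lra.
  have th1 : k^-1 <= th * q ^+ 4.
    apply: (@le_trans _ _ th).
      rewrite /th -[leRHS]invrK -expRN opprK lef_pV2 ?posrE ?expR_gt0 //.
      by apply: le_trans Yk; rewrite ler_expR; lra.
    by rewrite -[leLHS]mulr1 ler_pM2l.
  apply: (@le_trans _ _ (expR (Y / 4) * (5 * (th * q ^+ 4)))).
    apply: ler_pM => //.
    - rewrite exprn_ge0 // addr_ge0 // !mulr_ge0 ?invr_ge0 ?ler0n //;
      by lra.
    - apply: addr_ge0; last by rewrite invr_ge0 ltW.
      by rewrite divr_ge0 ?mulr_ge0 ?ltW.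
    - by rewrite -q4; lra.
  have -> : expR (Y / 4) * (5 * (th * q ^+ 4)) = 5 * q ^+ 4 / expR (Y / 4).
    have -> : th = (expR (Y / 4))^-1 ^+ 2.
      by rewrite /th -expRN -(expRM_natl 2); congr expR; field.
    by field; rewrite gt_eqF // expR_gt0.
  rewrite ler_pdivrMr ?expR_gt0 //.
  have -> : del = (q ^+ 4)^-1 by rewrite q4 invrK.
  apply: (@le_trans _ _ ((q ^+ 4)^-1 / (4 * D ^+ 2) * (20 * D ^+ 2 * q ^+ 8))).
    rewrite le_eqVlt; apply/orP; left; apply/eqP.
    by field; rewrite !gt_eqF.
  apply: ler_wpM2l => //.
  by rewrite mulr_ge0 ?invr_ge0 ?(ltW q40) // mulr_ge0 // ltW.
apply/negP; rewrite -ltNge; apply: (lt_le_trans dlt).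
by rewrite -exprVn exprVn q4 invrK.
Qed.

(** Always [|x|_1^2 <= n |x|_2^2]; for [n <= k] the ARIP would cover all vectors and make [A]
    injective, against its rank. The row mass bound relies on [k <= n]. *)
Lemma arip_order_lt_dim m n (A : 'M[R]_(m, n)) (kap D k del : R) :
  (0 < n)%N -> 0 < kap -> 0 < del ->
  (forall x : 'cV[R]_n, l1norm x ^+ 2 <= k * sqn x ->
    kap * sqn x <= sqn (A *m x) <= D ^+ 2 * kap * sqn x) ->
  (\rank A)%:R = (1 - del) * n%:R -> k < n%:R.
Proof.
move=> n0 kap0 del0 arip rkA; rewrite ltNge; apply/negP => nk.
have [|j [u [_ Au _ hu]]] := @kernel_vector_peaked m n A setT del del0 n0.
  by rewrite setCT cards0 subr0 rkA; lra.
have comp : l1norm u ^+ 2 <= k * sqn u.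
  apply: (@le_trans _ _ (n%:R * sqn u)).
    have := @l1norm_sparse n u setT; rewrite cardsT card_ord; apply.
    by move=> i; rewrite inE.
  by rewrite ler_wpM2r ?sqn_ge0.
have /andP[h _] := arip _ comp; rewrite Au sqn0 in h.
have : 0 < kap * sqn u by rewrite mulr_gt0 //; lra.
by lra.
Qed.

End SpreadRows.

(** * The submatrix of spread rows and its properties *)

Theorem theorem4 (R : realType) :
  exists C c : R, [/\ 0 < C, 0 < c &
    forall (m n : nat) (A : 'M[R]_(m, n)) (alpha k D eta : R),
      0 < alpha -> alpha < 1 ->
      (\rank A)%:R = alpha * n%:R ->
      1 <= k -> 1 <= D ->
      l2_ARIP k D A ->
      0 < eta ->
      64 * D ^+ 8 / (1 - alpha) ^+ 4 <= n%:R `^ eta ->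
      n%:R `^ eta <= k / D ^+ 2 ->
      exists (t : nat) (f : 'I_t -> 'I_m),
        let T := rowsub f A in
        let s := c * (eta * Num.sqrt (1 - alpha) * ln n%:R / D ^+ 3) in
        (t <= m)%N /\
        (forall i j : 'I_t, (i < j)%N -> (f i < f j)%N) /\
        n%:R `^ (- eta) <= frobenius T ^+ 2 / frobenius A ^+ 2 /\
        k / (D ^+ 2 * n%:R `^ eta) <= t%:R /\
        (forall i : 'I_t,
          row i T != 0 /\
          Delta12 (row i T)^T <=
            C * Num.sqrt (D ^+ 3 * n%:R /
                          (eta * Num.sqrt (1 - alpha) * ln n%:R))) /\
        (forall i : 'I_t,
          far_from_sparse (Num.sqrt (s / n%:R)) s (row i T)^T)].
Proof.
(* A spread row has [Delta12 ^+ 2 < n / L], and [L] carries the factor [1 / 480 ^+ 2], whence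
   [C = 480]; [c] is chosen so that [4 * s = L]. *)
exists 480, (1 / (4 * 480 ^+ 2)); split => //.
  by rewrite mulr_gt0 ?invr_gt0 ?mulr_gt0 ?exprn_gt0 ?ltr0n.
move=> m n A alpha k D eta alpha0 alpha1 rkA k1 D1 arip eta0 hlow hup.
pose del := 1 - alpha.
have del0 : 0 < del by rewrite /del; lra.
have del1 : del <= 1 by rewrite /del; lra.
have D0 : 0 < D by lra.
have D20 : 0 < D ^+ 2 by rewrite exprn_gt0.
have D30 : 0 < D ^+ 3 by rewrite exprn_gt0.
have k0 : 0 < k by lra.
pose Y := eta * ln (n%:R : R).
(* This gives [n > 0] and [Y > 0], and later absorbs the factor 4 of the row mass bound. *)
have N64 : 64 <= n%:R `^ eta.
  apply: le_trans hlow; rewrite ler_pdivlMr ?exprn_gt0 // ler_pM2l ?ltr0n //.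
  apply: (@le_trans _ _ 1); first by rewrite exprn_ile1 // ltW.
  by rewrite expr_ge1 // ltW.
have n0 : (0 < n)%N.
  rewrite lt0n; apply/eqP => nz; move: N64.
  by rewrite nz powR0 ?gt_eqF //; lra.
have nR : 0 < n%:R :> R by rewrite ltr0n.
have NE : n%:R `^ eta = expR Y by rewrite /powR gt_eqF.
have Y0 : 0 < Y.
  rewrite -ltr_expR expR0 -NE; lra.
have rk' : (\rank A)%:R = (1 - del) * n%:R by rewrite rkA /del; ring.
have Yk : D ^+ 2 * expR Y <= k by move: hup; rewrite NE ler_pdivlMr // mulrC.
have Yk' : expR Y <= k.
  by apply: le_trans Yk; rewrite ler_peMl ?expR_ge0 // expr_ge1 // ltW.
have [kap kap0 arip'] := arip_sqr k0 (ltW D0) arip.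
have kn := arip_order_lt_dim n0 kap0 del0 arip' rk'.
pose L := Y * Num.sqrt del / D ^+ 3 / 480 ^+ 2.
have sd0 : 0 < Num.sqrt del by rewrite sqrtr_gt0.
have L0 : 0 < L.
  rewrite /L; apply: divr_gt0; last by rewrite exprn_gt0 // ltr0n.
  by apply: divr_gt0 => //; apply: mulr_gt0.
pose G := [set i | L * (\sum_j A i j ^+ 2) < (\sum_j `|A i j|) ^+ 2].
have mass : expR (- (Y / 2)) * (\sum_i \sum_j A i j ^+ 2) <=
    \sum_(i in G) \sum_j A i j ^+ 2.
  exact: (spread_rows_mass n0 kap0 D1 k1 del0 del1 (ltW Y0) arip' rk' Yk').
have /andP[hF _] := frobenius_mass k1 arip'.
have F0 : 0 < \sum_i \sum_j A i j ^+ 2 by rewrite (lt_le_trans _ hF) ?mulr_gt0.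
have frobE p (B : 'M[R]_(p, n)) : frobenius B ^+ 2 = \sum_i \sum_j B i j ^+ 2.
  by rewrite sqr_sqrtr //; do 2!(apply: sumr_ge0 => ? _); apply: sqr_ge0.
(* This enumeration follows the order of ['I_m], so the rows of [T] keep their order in [A]. *)
pose f (i : 'I_#|G|) : 'I_m := Order.enum_val i.
have sqnT i : sqn (row i (rowsub f A))^T = \sum_j A (f i) j ^+ 2.
  by apply: eq_bigr => j _; rewrite !mxE.
have l1T i : l1norm (row i (rowsub f A))^T = \sum_j `|A (f i) j|.
  by apply: eq_bigr => j _; rewrite !mxE.
have rowT i :
    L * sqn (row i (rowsub f A))^T < l1norm (row i (rowsub f A))^T ^+ 2.
  by have := Order.EnumVal.enum_valP i; rewrite inE -/(f i) sqnT l1T.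
have mass0 : 0 < \sum_(i in G) \sum_j A i j ^+ 2.
  by apply: lt_le_trans mass; rewrite mulr_gt0 ?expR_gt0.
have sumT (F : 'I_m -> R) : \sum_(i < #|G|) F (f i) = \sum_(i in G) F i.
  (* Reindexing needs an element of [G]; the positive mass rules out the empty set. *)
  have [i0 i0G|G0] := pickP (mem G); last first.
    by move: mass0; rewrite big_pred0 ?ltxx // => i; have := G0 i.
  rewrite [RHS](reindex f); last first.
    by apply: Order.EnumVal.enum_val_bij_in i0G.
  by apply: eq_bigl => i; rewrite Order.EnumVal.enum_valP.
have e4 : 4 * expR (Y / 2) <= expR Y.
  have eE : expR Y = expR (Y / 2) ^+ 2.
    by rewrite -(expRM_natl 2); congr expR; field.
  have e0 := expR_gt0 (Y / 2).
  have : 64 <= expR (Y / 2) ^+ 2 by rewrite -eE -NE.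
  by rewrite eE; nra.
have uE : Y * Num.sqrt del / D ^+ 3 = eta * Num.sqrt del * ln n%:R / D ^+ 3.
  by rewrite /Y; ring.
exists #|G|, f => T s; split; [|split; [|split; [|split; [|split]]]].
- by rewrite -[leqRHS]card_ord max_card.
- move=> i j ij.
  have := leW_mono (Order.EnumVal.le_enum_val (@le_total _ 'I_m) (A := mem G)).
  by move=> /(_ i j); rewrite !ltEord ij -/(f i) -/(f j) => ->.
- rewrite powRN NE !frobE -expRN ler_pdivlMr //.
  have -> : \sum_i \sum_j T i j ^+ 2 = \sum_(i in G) \sum_j A i j ^+ 2.
    by rewrite -sumT; apply: eq_bigr => i _; apply: eq_bigr => j _; rewrite mxE.
  apply: le_trans mass; rewrite ler_pM2r // ler_expR; lra.
- rewrite NE ler_pdivrMr ?mulr_gt0 ?expR_gt0 //.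
  (* The spread rows have total mass at least [exp (- Y / 2) kap n] and each at most
     [4 n D^2 kap / k], so [t >= k exp (- Y / 2) / (4 D^2)]; [e4] trades the 4 for a second factor
     [exp (Y / 2)]. *)
  have h1 : k * \sum_(i in G) \sum_j A i j ^+ 2 <=
      #|G|%:R * (4 * n%:R * (D ^+ 2 * kap)).
    rewrite mulr_sumr mulr_natl -sumr_const; apply: ler_sum => i _.
    exact: row_mass kap0 k1 (ltW kn) arip'.
  have h2 : k * (expR (- (Y / 2)) * (kap * n%:R)) <=
      #|G|%:R * (4 * n%:R * (D ^+ 2 * kap)).
    apply: le_trans h1; rewrite ler_pM2l //; apply: le_trans mass.
    by rewrite ler_pM2l ?expR_gt0.
  have kn0 : 0 < kap * n%:R * expR (- (Y / 2)) by rewrite !mulr_gt0 ?expR_gt0.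
  rewrite -(ler_pM2r kn0).
  have -> : k * (kap * n%:R * expR (- (Y / 2))) =
      k * (expR (- (Y / 2)) * (kap * n%:R)) by ring.
  apply: (le_trans h2).
  have -> : #|G|%:R * (D ^+ 2 * expR Y) * (kap * n%:R * expR (- (Y / 2))) =
      #|G|%:R * (expR Y * expR (- (Y / 2)) * n%:R * (D ^+ 2 * kap)) by ring.
  apply: ler_wpM2l; first by rewrite ler0n.
  apply: ler_wpM2r; first by rewrite ltW // mulr_gt0.
  apply: ler_wpM2r; first by rewrite ler0n.
  by rewrite expRN ler_pdivlMr ?expR_gt0.
- move=> i; have h := rowT i; rewrite -/T in h.
  (* Strictness in the definition of spread excludes zero rows. *)
  have T0 : row i T != 0.
    apply/eqP => Ti; move: h; rewrite Ti trmx0 sqn0 l1norm0.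
    by rewrite mulr0 expr0n ltxx.
  split => //; set x := (row i T)^T in h *.
  have l1x : 0 < l1norm x.
    rewrite lt_neqAle l1norm_ge0 andbT eq_sym; apply/eqP => l0.
    move: h; rewrite l0 expr0n /= ltNge mulr_ge0 ?sqn_ge0 //; exact: ltW.
  have w0 : 0 < eta * Num.sqrt del * ln n%:R.
    by rewrite mulrAC mulr_gt0.
  have r0 : 0 <= D ^+ 3 * n%:R / (eta * Num.sqrt del * ln n%:R).
    by rewrite ltW // divr_gt0 // mulr_gt0.
  rewrite /Delta12 ler_pdivrMr //.
  rewrite -(@ler_pXn2r _ 2) ?nnegrE ?mulr_ge0 ?sqrtr_ge0 ?l1norm_ge0 ?ler0n //.
  rewrite !exprMn l2norm_sqr !sqr_sqrtr ?ler0n //.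
  have -> : 480 ^+ 2 * (D ^+ 3 * n%:R / (eta * Num.sqrt del * ln n%:R)) =
      n%:R / L.
    rewrite /L uE; set w := eta * _ * _ in w0 *.
    by field; rewrite !gt_eqF.
  by rewrite [leRHS]mulrAC ler_pdivlMr // -mulrA mulrCA ler_pM2l // mulrC ltW.
- move=> i; apply: (@spread_far_from_sparse _ _ L) => //.
  + rewrite /s -/del -uE; apply: mulr_ge0.
      by rewrite divr_ge0 // mulr_ge0 // ?exprn_ge0 // ler0n.
    by rewrite ltW // divr_gt0 // mulr_gt0.
  + rewrite /s -/del -uE /L le_eqVlt; apply/orP; left; apply/eqP.
    by field; rewrite gt_eqF.
Qed.
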